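(* Let $\mathbb{A}$ be any set of allowable test processes. For all $\omega\in\Omega$, $[0,1]\in\mathcal{I}_{\mathbb{A}}(\omega)\subseteq\mathcal{I}_{\mathrm{S}}(\omega)$; so any path $\omega$ has at least one stationary forecast that makes it $\mathbb{A}$-random and therefore also Schnorr random: $\mathcal{I}_{\mathbb{A}}(\omega)\ne\emptyset$ and $\mathcal{I}_{\mathrm{S}}(\omega)\ne\emptyset$.
   Context: Notation: $\mathbb{N}=\{1,2,\dots\}$, $\mathbb{N}_0=\mathbb{N}\cup\{0\}$. Situations are the finite binary sequences $\mathbb{S}=\bigcup_{n\in\mathbb{N}_0}\{0,1\}^n$, with $\square$ the empty sequence; $sx$ is $s$ with $x\in\{0,1\}$ appended. Paths are elements $\omega$ of $\Omega=\{0,1\}^{\mathbb{N}}$; $\omega_{1:n}\in\mathbb{S}$ consists of the first $n$ entries. $\mathcal{I}$ is the set of non-empty closed subintervals of $[0,1]$. For $f\colon\{0,1\}\to\mathbb{R}$ and $I\in\mathcal{I}$, $\overline{E}_I(f)=\max_{p\in I}[pf(1)+(1-p)f(0)]$. A forecasting system is a map $\varphi\colon\mathbb{S}\to\mathcal{I}$. For $I\in\mathcal{I}$, the stationary forecasting system $\gamma_I$ is given by $\gamma_I(s)=I$ for all $s\in\mathbb{S}$. A real process is a map $F\colon\mathbb{S}\to\mathbb{R}$, with $\Delta F(s)(x)=F(sx)-F(s)$. A test process is a non-negative real process with $F(\square)=1$. A supermartingale for $\varphi$ is a real process $M$ with $\overline{E}_{\varphi(s)}(\Delta M(s))\le 0$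 for all $s\in\mathbb{S}$; a test supermartingale for $\varphi$ is a test process that is a supermartingale for $\varphi$. Computability: ''recursive'' means computable by a Turing machine (countable sets such as $\mathbb{S}$ and $\mathbb{S}\times\mathbb{N}_0$ are identified with $\mathbb{N}_0$ by recursive bijections with recursive inverse). A real process $F$ is computable if there are a recursive family of rationals $r_{s,n}$ and a recursive map $e\colon\mathbb{S}\times\mathbb{N}_0\to\mathbb{N}_0$ such that $n\ge e(s,N)$ implies $|r_{s,n}-F(s)|\le 2^{-N}$. A set of allowable test processes is any countable set $\mathbb{A}$ of test processes that contains all computable (strictly) positive test processes. A path $\omega$ is $\mathbb{A}$-random for $\varphi$ if $\sup_{n\in\mathbb{N}}T(\omega_{1:n})<\infty$ for every $T\in\mathbb{A}$ that is a test supermartingale for $\varphi$. A growth function is a recursive, non-decreasing, unbounded map $\rho\colon\mathbb{N}_0\to\mathbb{N}_0$. A path $\omega$ is Schnorr random for $\varphi$ if $\limsup_{n\to\infty}[T(\omega_{1:n})-\rho(n)]\le 0$ for all computable test supermartingales $T$ for $\varphi$ and all growth functions $\rho$. $\mathcal{I}_{\mathbb{A}}(\omega)=\{I\in\mathcal{I}:\omega\text{ is }\mathbb{A}\text{-random for }\gamma_I\}$ and $\mathcal{I}_{\mathrm{S}}(\omega)=\{I\in\mathcal{I}:\omega\text{ is Schnorr random for }\gamma_I\}$. *)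

(* Defs.v *)
From mathcomp Require Import all_boot all_order all_algebra.
From mathcomp Require Import all_classical all_reals all_analysis.
From mathcomp Require Import ring lra.
Set Implicit Arguments.
Unset Strict Implicit.
Unset Printing Implicit Defensive.
Import Order.TTheory GRing.Theory Num.Theory.
Local Open Scope classical_set_scope.
Local Open Scope ring_scope.

(** * Turing machines and recursive maps *)

Inductive symbol := Bit of bool | Sep.

(** [W] is a machine-dependent finite set of additional work symbols, and
    [None] is the blank. *)
Definition cell (W : Type) := option (symbol + W).

Inductive move := Left | Stay | Right.

(** Deterministic machines with one two-way infinite tape; the machine halts
    when [delta] is undefined. *)
Record machine := Machine {
  state : finType;
  work : finType;
  start : state;
  delta : state -> cell work -> option (state * cell work * move) }.

(** Tape positions are counted relative to the head, which is thus always at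
    position [0]; moving the head shifts the tape. *)
Definition tape (W : Type) := int -> cell W.

Definition config (M : machine) := (state M * tape (work M))%type.

Definition offset (d : move) : int :=
  match d with Left => -1 | Stay => 0 | Right => 1 end.

Definition step (M : machine) (c : config M) : config M :=
  if delta c.1 (c.2 0) is Some (q, a, d) then
    (q, fun i => let j := i + offset d in if j == 0 then a else c.2 j)
  else c.

Definition halted (M : machine) (c : config M) : Prop :=
  delta c.1 (c.2 0) = None.

(** The tape that is blank except for [w], with the head on its first symbol. *)
Definition word_tape (W : Type) (w : seq symbol) : tape W :=
  fun i => if i is Posz n then omap inl (onth w n) else None.

Definition computes (M : machine) (w v : seq symbol) : Prop :=
  exists n, let c := iter n (@step M) (start M, word_tape (work M) w) in
    halted c /\ c.2 =1 word_tape (work M) v.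

(** The countable sets that occur below are coded by words; naturals are
    written in unary. *)
Definition recursive (X Y : Type) (cX : X -> seq symbol) (cY : Y -> seq symbol)
    (f : X -> Y) : Prop :=
  exists M, forall x, computes M (cX x) (cY (f x)).

Definition situation := seq bool.

Definition code_nat (n : nat) : seq symbol := nseq n (Bit true).

Definition code_situation_nat (x : situation * nat) : seq symbol :=
  map Bit x.1 ++ Sep :: code_nat x.2.

(** A fraction [z / d], as the sign and the absolute value of [z], and [d]. *)
Definition code_fraction (x : int * nat) : seq symbol :=
  Bit (0 <= x.1) :: code_nat `|x.1|%N ++ Sep :: code_nat x.2.

Definition recursive_rationals (r : situation -> nat -> rat) : Prop :=
  exists2 g : situation * nat -> int * nat,
    recursive code_situation_nat code_fraction g &
    forall s n, (0 < (g (s, n)).2)%N /\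
                r s n = (g (s, n)).1%:~R / (g (s, n)).2%:R.

Definition recursive_modulus (e : situation -> nat -> nat) : Prop :=
  recursive code_situation_nat code_nat (fun x => e x.1 x.2).

Definition growth_function (rho : nat -> nat) : Prop :=
  [/\ recursive code_nat code_nat rho,
      {homo rho : m n / (m <= n)%N} &
      forall k, exists n, (k < rho n)%N].

(** * Forecasts, processes and supermartingales *)

Record forecast (R : realType) := Forecast {
  lower : R;
  upper : R;
  lower_ge0 : 0 <= lower;
  lower_le_upper : lower <= upper;
  upper_le1 : upper <= 1 }.

Definition set_of_forecast (R : realType) (I : forecast R) : set R :=
  `[lower I, upper I].
Coercion set_of_forecast : forecast >-> set.

Definition unit_forecast (R : realType) : forecast R :=
  Forecast (lexx 0) ler01 (lexx 1).

Definition expectation (R : realType) (f : bool -> R) (p : R) : R :=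
  p * f true + (1 - p) * f false.

(** The supremum is a maximum, by [upper_expectation_max] below. *)
Definition upper_expectation (R : realType) (I : forecast R) (f : bool -> R) : R :=
  sup [set expectation f p | p in (I : set R)].

Lemma upper_expectation_max (R : realType) (I : forecast R) (f : bool -> R) :
  (exists2 p, (I : set R) p & upper_expectation I f = expectation f p) /\
  (forall p, (I : set R) p -> expectation f p <= upper_expectation I f).
Proof.
have [p Ip pmax] : exists2 p, (I : set R) p &
    forall q, (I : set R) q -> expectation f q <= expectation f p.
  have := lower_le_upper I; rewrite /set_of_forecast /expectation => lu.
  have [h|h] := leP (f false) (f true); [exists (upper I)|exists (lower I)];
    rewrite /= ?in_itv/= ?lu ?lexx// => q; rewrite in_itv/= => /andP[lq qu]; nra.
suff -> : upper_expectation I f = expectation f p by split; [exists p|].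
apply/eqP; rewrite eq_le; apply/andP; split.
  by apply: ge_sup; [exists (expectation f p), p|move=> _ [q Iq <-]; exact: pmax].
apply: ub_le_sup; last by exists p.
by exists (expectation f p) => _ [q Iq <-]; exact: pmax.
Qed.

Definition forecasting_system (R : realType) := situation -> forecast R.

Definition stationary (R : realType) (I : forecast R) : forecasting_system R :=
  fun=> I.

Definition process (R : realType) := situation -> R.

Definition increment (R : realType) (F : process R) (s : situation) : bool -> R :=
  fun x => F (rcons s x) - F s.

Definition test_process (R : realType) (F : process R) : Prop :=
  (forall s, 0 <= F s) /\ F [::] = 1.

Definition supermartingale (R : realType) (phi : forecasting_system R)
    (M : process R) : Prop :=
  forall s, upper_expectation (phi s) (increment M s) <= 0.

Definition test_supermartingale (R : realType) (phi : forecasting_system R)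
    (T : process R) : Prop :=
  test_process T /\ supermartingale phi T.

Definition computable (R : realType) (F : process R) : Prop :=
  exists r : situation -> nat -> rat, exists e : situation -> nat -> nat,
    [/\ recursive_rationals r, recursive_modulus e &
        forall s N n, (e s N <= n)%N -> `|ratr (r s n) - F s| <= 2 ^- N].

Definition allowable (R : realType) (A : set (process R)) : Prop :=
  [/\ countable A,
      forall T, A T -> test_process T &
      forall T, test_process T -> (forall s, 0 < T s) -> computable T -> A T].

(** * Randomness *)

(** Indexed from [0]: [omega 0] is the first entry. *)
Definition bit_path := nat -> bool.

Definition initial (omega : bit_path) (n : nat) : situation := mkseq omega n.

Definition random (R : realType) (A : set (process R))
    (phi : forecasting_system R) (omega : bit_path) : Prop :=
  forall T, A T -> test_supermartingale phi T ->
    (ereal_sup [set (T (initial omega n))%:E | n in [set n | (0 < n)%N]] < +oo)%E.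

Definition schnorr_random (R : realType) (phi : forecasting_system R)
    (omega : bit_path) : Prop :=
  forall (T : process R) (rho : nat -> nat),
    computable T -> test_supermartingale phi T -> growth_function rho ->
    (limn_esup (fun n => (T (initial omega n) - (rho n)%:R)%:E) <= 0)%E.

Definition random_forecasts (R : realType) (A : set (process R))
    (omega : bit_path) : set (forecast R) :=
  [set I | random A (stationary I) omega].

Definition schnorr_forecasts (R : realType) (omega : bit_path) : set (forecast R) :=
  [set I | schnorr_random (stationary I) omega].

Arguments schnorr_forecasts : clear implicits.

(* Main.v *)
(** If [T] is a computable test supermartingale, then so is [(T + 1) / 2]; it
    is moreover strictly positive, so it belongs to every allowable set, and
    along a random path it stays bounded. Then so does [T], and every growth
    function overtakes it. A test supermartingale for [[0, 1]] cannot increase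
    along any path, so it is bounded by [1].

    That [(T + 1) / 2] is computable needs a Turing machine: a machine that
    approximates [T] by fractions [z / d] is followed by one that maps [z / d]
    to [(|z| + d) / (2 d)]. Since [T >= 0], passing from [z] to [|z|] does not
    worsen the approximation. *)
From HB Require Import structures.
Require Import Defs.
From mathcomp Require Import all_boot all_order all_algebra.
From mathcomp Require Import all_classical all_reals all_analysis.
From mathcomp Require Import ring lra zify.
Set Implicit Arguments.
Unset Strict Implicit.
Unset Printing Implicit Defensive.
Import Order.TTheory GRing.Theory Num.Theory.
Local Open Scope classical_set_scope.
Local Open Scope ring_scope.

(** * Runs of Turing machines and their sequential composition *)

Definition reaches (M : machine) (c c' : config M) : Prop :=
  exists n, iter n (@step M) c = c'.

Lemma reaches_refl (M : machine) (c : config M) : reaches c c.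
Proof. by exists 0%N. Qed.

Lemma reaches_trans (M : machine) (c2 c1 c3 : config M) :
  reaches c1 c2 -> reaches c2 c3 -> reaches c1 c3.
Proof. by move=> [m <-] [n <-]; exists (n + m)%N; rewrite iterD. Qed.

Lemma reaches_step (M : machine) (c : config M) : reaches c (step c).
Proof. by exists 1%N. Qed.

Lemma computesP (M : machine) (w v : seq symbol) :
  computes M w v <->
  exists2 q, reaches (start M, word_tape (work M) w) (q, word_tape (work M) v) &
             halted (M := M) (q, word_tape (work M) v).
Proof.
split=> [[n [h e]]|[q [n e] h]]; last by exists n; rewrite e.
move: h e; case E : (iter _ _ _) => [q t] /= h /funext e; subst t.
by exists q => //; exists n.
Qed.

Definition cell_map (W W' : Type) (f : W -> W') (a : cell W) : cell W' :=
  omap (fun x => match x with inl b => inl b | inr w => inr (f w) end) a.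

(** The outer [None] rejects a foreign work symbol, the inner one is the blank. *)
Definition cell_restrict (W W' : Type) (g : W' -> option W) (a : cell W') :
    option (cell W) :=
  match a with
  | Some (inr w) => omap (Some \o inr) (g w)
  | Some (inl b) => Some (Some (inl b))
  | None => Some None
  end.

Lemma cell_mapK (W W' : Type) (f : W -> W') (g : W' -> option W) :
  pcancel f g -> pcancel (cell_map f) (cell_restrict g).
Proof. by move=> fK [[b|w]|] //=; rewrite fK. Qed.

Lemma word_tape_map (W W' : Type) (f : W -> W') (w : seq symbol) (i : int) :
  cell_map f (word_tape W w i) = word_tape W' w i.
Proof. by case: i => //= n; case: onth. Qed.

Lemma reaches_embed (M N : machine) (i : state M -> state N)
    (f : work M -> work N) :
  (forall q a q' b d, delta q a = Some (q', b, d) ->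
     delta (i q) (cell_map f a) = Some (i q', cell_map f b, d)) ->
  forall (q q' : state M) t t', reaches (q, t) (q', t') ->
    reaches (i q, cell_map f \o t) (i q', cell_map f \o t').
Proof.
move=> hd q q' t t' [n]; elim: n q t => [|n IH] q t.
  by move=> [<- <-]; exact: reaches_refl.
rewrite iterSr /step /=.
case E : (delta q (t 0)) => [[[q1 b] d]|]; last exact: IH.
move=> /IH; apply: reaches_trans.
suff -> : (i q1, cell_map f \o (fun j => if j + offset d == 0 then b
    else t (j + offset d))) = step (M := N) (i q, cell_map f \o t).
  exact: reaches_step.
rewrite /step /= (hd _ _ _ _ _ E); congr pair.
by apply/funext => j /=; case: ifP.
Qed.

Definition sum_left (T T' : Type) (x : T + T') : option T :=
  if x is inl y then Some y else None.

Definition sum_right (T T' : Type) (x : T + T') : option T' :=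
  if x is inr y then Some y else None.

Definition seq_delta (M N : machine) (q : state M + state N)
    (a : cell (work M + work N)) :
    option ((state M + state N) * cell (work M + work N) * move) :=
  match q with
  | inl q =>
      if cell_restrict (@sum_left _ _) a is Some b then
        if delta q b is Some (q', c, d) then Some (inl q', cell_map inl c, d)
        else Some (inr (start N), a, Stay)
      else None
  | inr q =>
      if cell_restrict (@sum_right _ _) a is Some b then
        if delta q b is Some (q', c, d) then Some (inr q', cell_map inr c, d)
        else None
      else None
  end.

Definition seq_machine (M N : machine) : machine :=
  Machine (inl (start M)) (@seq_delta M N).

Lemma seq_delta_inl (M N : machine) (q : state M) (a : cell (work M)) :
  seq_delta (N := N) (inl q) (cell_map inl a) =
  if delta q a is Some (q', b, d) then Some (inl q', cell_map inl b, d)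
  else Some (inr (start N), cell_map inl a, Stay).
Proof. by rewrite /seq_delta cell_mapK. Qed.

Lemma seq_delta_inr (M N : machine) (q : state N) (a : cell (work N)) :
  seq_delta (M := M) (inr q) (cell_map inr a) =
  if delta q a is Some (q', b, d) then Some (inr q', cell_map inr b, d)
  else None.
Proof. by rewrite /seq_delta cell_mapK. Qed.

(** The run of [M], one hand-over step that leaves the tape as it is, and the run of [N]. The
    intermediate word has no work symbols, so both machines read it alike. *)
Lemma seq_machine_computes (M N : machine) (u v w : seq symbol) :
  computes M u v -> computes N v w -> computes (seq_machine M N) u w.
Proof.
have wtE W W' (f : W -> W') x : cell_map f \o word_tape W x = word_tape W' x.
  by apply/funext => i; exact: word_tape_map.
move=> /computesP[q1 r1 h1] /computesP[q2 r2 h2]; apply/computesP.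
exists (inr q2); last first.
  change (seq_delta (M := M) (inr q2)
    (word_tape (work M + work N) w 0) = None).
  by rewrite -(word_tape_map inr) seq_delta_inr (h2 : delta _ _ = None).
have e1 : reaches (M := seq_machine M N) (inl (start M), word_tape _ u)
    (inl q1, word_tape _ v).
  have := @reaches_embed M (seq_machine M N) inl inl _ _ _ _ _ r1.
  by rewrite !wtE; apply => q a q' b d E; rewrite [LHS]seq_delta_inl E.
have e2 : reaches (M := seq_machine M N) (inr (start N), word_tape _ v)
    (inr q2, word_tape _ w).
  have := @reaches_embed N (seq_machine M N) inr inr _ _ _ _ _ r2.
  by rewrite !wtE; apply => q a q' b d E; rewrite [LHS]seq_delta_inr E.
apply: (reaches_trans e1); apply: reaches_trans e2.
suff -> : (inr (start N), word_tape _ v) =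
    step (M := seq_machine M N) (inl q1, word_tape _ v).
  exact: reaches_step.
have E : seq_delta (N := N) (inl q1) (word_tape (work M + work N) v 0) =
    Some (inr (start N), word_tape (work M + work N) v 0, Stay).
  by rewrite -(word_tape_map inl) seq_delta_inl (h1 : delta _ _ = None).
rewrite /step [delta _ _]E; congr pair; apply/funext => j.
by rewrite addr0; case: eqP => [->|].
Qed.

Lemma recursive_comp (X Y Z : Type) (cX : X -> seq symbol)
    (cY : Y -> seq symbol) (cZ : Z -> seq symbol) (f : X -> Y) (g : Y -> Z) :
  recursive cX cY f -> recursive cY cZ g -> recursive cX cZ (g \o f).
Proof.
move=> [M hM] [N hN]; exists (seq_machine M N) => x.
exact: seq_machine_computes (hM x) (hN (f x)).
Qed.

(** * Tapes split at the head, and sweeps over them *)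

(** [l] lists the cells to the left of the head, nearest first, and [r] those
    from the head onwards; the tape is blank beyond both lists. *)
Definition zipper (W : Type) (l r : seq (cell W)) : tape W :=
  fun i => match i with Posz n => nth None r n | Negz n => nth None l n end.

Lemma word_tapeE (W : Type) (w : seq symbol) :
  word_tape W w = zipper [::] (map (Some \o inl) w).
Proof.
apply/funext => -[n|n] /=; last by rewrite nth_nil.
by elim: w n => [|x w IH] [|n] //=.
Qed.

Lemma zipper_rcons_blank (W : Type) (l r : seq (cell W)) :
  zipper (rcons l None) (rcons r None) = zipper l r.
Proof. by apply/funext => -[n|n] /=; rewrite nth_rcons_default. Qed.

(** Reading an empty list as blank, through [head None] and [behead], spares a case distinction at
    the ends of the tape. *)
Lemma step_zipper (M : machine) (q q' : state M) (a : cell (work M)) (d : move)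
    (l r : seq (cell (work M))) :
  delta q (head None r) = Some (q', a, d) ->
  reaches (q, zipper l r) (q', match d with
    | Left => zipper (behead l) (head None l :: a :: behead r)
    | Stay => zipper l (a :: behead r)
    | Right => zipper (a :: l) (behead r)
    end).
Proof.
move=> E; exists 1%N; rewrite /= /step /= nth0 E; congr pair.
apply/funext => i; case: d {E} => /=.
- case: i => [[|[|n]]|n].
  + by rewrite add0r /= nth0.
  + by rewrite subrr.
  + have -> : Posz n.+2 + -1 = Posz n.+1 by lia.
    by rewrite /= nth_behead.
  + have -> : Negz n + -1 = Negz n.+1 by lia.
    by rewrite /= nth_behead.
- by rewrite addr0; case: i => [[|n]|n] //=; rewrite nth_behead.
- case: i => [n|[|n]].
  + have -> : Posz n + 1 = Posz n.+1 by lia.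
    by rewrite /= nth_behead.
  + by [].
  + have -> : Negz n.+1 + 1 = Negz n by lia.
    by [].
Qed.

Lemma sweep_right (M : machine) (T : eqType) (q : state M)
    (h k : T -> cell (work M)) (u : seq T) (l r : seq (cell (work M))) :
  {in u, forall x, delta q (h x) = Some (q, k x, Right)} ->
  reaches (q, zipper l (map h u ++ r)) (q, zipper (rev (map k u) ++ l) r).
Proof.
elim: u l => [|x u IH] l E; first exact: reaches_refl.
apply: reaches_trans.
  by apply: (step_zipper (d := Right)); exact: (E x (mem_head x u)).
rewrite /= rev_cons cat_rcons; apply: IH => y yu.
by apply: E; rewrite in_cons yu orbT.
Qed.

(** The list [l'] holds the cells from the head leftwards, the head's own cell first; with this form
    the induction on [u] needs no special case for its last cell. *)
Lemma sweep_left (M : machine) (T : eqType) (q : state M)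
    (h k : T -> cell (work M)) (u : seq T) (l r : seq (cell (work M))) :
  {in u, forall x, delta q (h x) = Some (q, k x, Left)} ->
  let l' := map h u ++ l in
  reaches (q, zipper (behead l') (head None l' :: r))
          (q, zipper (behead l) (head None l :: rev (map k u) ++ r)).
Proof.
elim: u r => [|x u IH] r E /=; first exact: reaches_refl.
apply: reaches_trans.
  by apply: (step_zipper (d := Left)); exact: (E x (mem_head x u)).
rewrite /= rev_cons cat_rcons; apply: IH => y yu.
by apply: E; rewrite in_cons yu orbT.
Qed.

(** * A machine that averages a fraction with one *)

Inductive averaging_state :=
  ToSep | FindOne | ToRightEnd | ToLeftEnd | Restore | Done.

Definition averaging_state_code (q : averaging_state) : 'I_6 :=
  inord (match q with ToSep => 0 | FindOne => 1 | ToRightEnd => 2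
    | ToLeftEnd => 3 | Restore => 4 | Done => 5 end).

Definition averaging_state_decode (i : 'I_6) : averaging_state :=
  nth Done [:: ToSep; FindOne; ToRightEnd; ToLeftEnd; Restore; Done] i.

Lemma averaging_state_codeK :
  cancel averaging_state_code averaging_state_decode.
Proof. by case; rewrite /averaging_state_decode /= inordK. Qed.

HB.instance Definition _ :=
  Finite.copy averaging_state (can_type averaging_state_codeK).

(** On [b 1^a # 1^d], each [1] of the right block is turned into [0], a [0] is
    appended at the right end and a [1] is prepended at the left end. When the
    original right block is exhausted, the tape reads [1^d b 1^a # 0^(2d)], and
    a last sweep to the left turns every bit into [1]. *)
Definition averaging_delta (q : averaging_state) (x : cell void) :
    option (averaging_state * cell void * move) :=
  match q, x with
  | ToSep, Some (inl (Bit _)) => Some (ToSep, x, Right)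
  | ToSep, Some (inl Sep) => Some (FindOne, x, Right)
  | FindOne, Some (inl (Bit false)) => Some (FindOne, x, Right)
  | FindOne, Some (inl (Bit true)) =>
      Some (ToRightEnd, Some (inl (Bit false)), Right)
  | FindOne, None => Some (Restore, x, Left)
  | ToRightEnd, Some (inl (Bit _)) => Some (ToRightEnd, x, Right)
  | ToRightEnd, None => Some (ToLeftEnd, Some (inl (Bit false)), Left)
  | ToLeftEnd, Some _ => Some (ToLeftEnd, x, Left)
  | ToLeftEnd, None => Some (ToSep, Some (inl (Bit true)), Stay)
  | Restore, Some (inl (Bit _)) => Some (Restore, Some (inl (Bit true)), Left)
  | Restore, Some (inl Sep) => Some (Restore, x, Left)
  | Restore, None => Some (Done, x, Right)
  | _, _ => None
  end.

Definition averaging_machine : machine := Machine ToSep averaging_delta.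

(** Loop invariant, by induction on the number [j] of ones still to be treated: [k] zeros in front
    are marked ones, [k] zeros behind are appended ones, and [u] has collected the prepended
    bits. *)
Lemma averaging_machine_reaches (u : seq bool) (j k : nat) :
  let bit b : cell void := Some (inl (Bit b)) in
  let sep : cell void := Some (inl Sep) in
  reaches (M := averaging_machine)
    (ToSep, zipper [::] (map bit u ++ sep ::
       map bit (nseq k false ++ nseq j true ++ nseq k false)))
    (Done, zipper [::] (map bit (nseq (j + size u) true) ++ sep ::
       map bit (nseq (k + j).*2 true))).
Proof.
move=> bit sep.
pose sweepr := @sweep_right averaging_machine bool ^~ bit.
pose sweepl := @sweep_left averaging_machine bool ^~ bit.
elim: j k u => [|j IH] k u;
  (apply: reaches_trans; first exact: (@sweepr _ bit));
  (apply: reaches_trans; first exact: (step_zipper (d := Right))).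
  (* No one is left: [FindOne] crosses all zeros up to the blank, and [Restore] sweeps back. *)
  rewrite /= cat_nseq /ncons -iterD -/(ncons _ _ _) -/(nseq _ _) addnn.
  set w := nseq _ false.
  rewrite -[map bit w]cats0; apply: reaches_trans.
    by apply: (@sweepr _ bit) => b /nseqP[->].
  apply: reaches_trans; first exact: (step_zipper (d := Left)).
  rewrite -map_rev; apply: reaches_trans.
    exact: (@sweepl _ (fun=> bit true)).
  apply: reaches_trans; first exact: (step_zipper (d := Left)).
  rewrite cats0 -map_rev -[map bit (rev u)]cats0; apply: reaches_trans.
    exact: (@sweepl _ (fun=> bit true)).
  apply: reaches_trans; first exact: (step_zipper (d := Right)).
  have mapE v : rev (map (fun=> bit true) (rev v)) =
      map bit (nseq (size v) true).
    by rewrite -map_rev revK map_nseq; elim: v => //= b v ->.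
  (* The head has visited one blank beyond each end, so both lists carry a spurious last [None]. *)
  rewrite /= !mapE size_nseq addn0 add0n cats1 -rcons_cons -rcons_cat.
  rewrite -[[:: None]]/(rcons [::] None) zipper_rcons_blank.
  exact: reaches_refl.
rewrite map_cat; apply: reaches_trans.
  by apply: (@sweepr _ bit) => b /nseqP[->].
apply: reaches_trans; first exact: (step_zipper (d := Right)).
rewrite /=; set w := _ ++ nseq k false.
rewrite -[map bit w]cats0; apply: reaches_trans.
  exact: (@sweepr _ bit).
apply: reaches_trans; first exact: (step_zipper (d := Left)).
rewrite -!map_rev -cat_cons -[_ :: map bit _]/(map bit (false :: _)).
rewrite catA -map_cat; apply: reaches_trans.
  exact: (@sweepl _ bit).
apply: reaches_trans; first exact: (step_zipper (d := Left)).
rewrite cats0 -[map bit (rev u)]cats0; apply: reaches_trans.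
  exact: (@sweepl _ bit).
apply: reaches_trans; first exact: (step_zipper (d := Stay)).
have revu : rev (map bit (rev u)) = map bit u by rewrite -map_rev revK.
(* The newly marked one joins the zeros in front and the appended zero those behind: the invariant
   with [k.+1]. *)
have revw : rev (map bit (rev w ++ false :: rev (nseq k false))) ++
    [:: bit false] =
    map bit (nseq k.+1 false ++ nseq j true ++ nseq k.+1 false).
  rewrite -map_rev rev_cat rev_cons !revK -cats1.
  rewrite -[[:: bit false]]/(map bit [:: false]) -map_cat.
  by rewrite -addn1 !nseqD -!catA.
have := IH k.+1 (true :: u).
rewrite map_cons -revw -{1}revu addSn !addnS.
exact.
Qed.

Lemma averaging_recursive :
  recursive code_fraction code_fraction
    (fun x => (Posz (`|x.1| + x.2), x.2.*2)).
Proof.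
exists averaging_machine => -[z d]; apply/computesP; exists Done => //.
rewrite !word_tapeE /code_fraction /code_nat /=.
(* The sign bit counts as part of [u]: of the resulting [d + |z| + 1] ones, the first is the sign of
   the new numerator. *)
have := averaging_machine_reaches ((0 <= z) :: nseq `|z| true) d 0.
rewrite cats0 add0n.
rewrite !(map_cat, map_cons, map_nseq) /= size_nseq addnS /= addnC.
by rewrite !map_nseq.
Qed.

(** * The process [(T + 1) / 2] *)

Definition average_with_one (R : realType) (T : process R) : process R :=
  fun s => (T s + 1) / 2.

Lemma computable_average_with_one (R : realType) (T : process R) :
  (forall s, 0 <= T s) -> computable T -> computable (average_with_one T).
Proof.
move=> T0 [r [e [[g hg rg] he hr]]].
(* The modulus [e] is kept, since averaging with one halves the error. *)
exists (fun s n => (`|r s n| + 1) / 2), e; split=> //.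
  exists (fun x => (Posz (`|(g x).1| + (g x).2), (g x).2.*2)).
    exact: recursive_comp hg averaging_recursive.
  move=> s n; have [d0 ->] := rg s n; split; first by rewrite double_gt0.
  have d1 : (g (s, n)).2%:R != 0 :> rat by rewrite pnatr_eq0 -lt0n.
  rewrite /= -muln2 natrM normrM normfV normr_nat.
  rewrite -pmulrn natrD natr_absz intr_norm.
  by field.
move=> s N n /hr; rewrite /average_with_one rmorphM fmorphV /= ratr_nat.
rewrite rmorphD rmorph1 /= ratr_norm => h.
have : `| `|ratr (r s n)| - T s | <= `|ratr (r s n) - T s|.
  by rewrite -[X in `|_ - X|](ger0_norm (T0 s)); exact: ler_dist_dist.
set a := `|ratr _|.
have -> : (a + 1) / 2 - (T s + 1) / 2 = (a - T s) / 2 by field.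
rewrite normrM (ger0_norm (x := 2^-1)) ?invr_ge0//.
have := normr_ge0 (a - T s); lra.
Qed.

Lemma expectation_average_with_one (R : realType) (T : process R) s p :
  Defs.expectation (increment (average_with_one T) s) p =
  Defs.expectation (increment T s) p / 2.
Proof. by rewrite /Defs.expectation /increment /average_with_one; field. Qed.

(** As the upper expectation is an attained maximum, the condition splits into one linear inequality
    per [p]. *)
Lemma supermartingale_le0 (R : realType) (phi : forecasting_system R)
    (T : process R) :
  supermartingale phi T <-> forall s p, (phi s : set R) p ->
    Defs.expectation (increment T s) p <= 0.
Proof.
split=> [h s p Ip|h s].
  apply: le_trans (h s).
  by have [_] := upper_expectation_max (phi s) (increment T s); apply.
have [[p Ip ->] _] := upper_expectation_max (phi s) (increment T s).
exact: h.
Qed.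

Lemma test_supermartingale_average_with_one (R : realType)
    (phi : forecasting_system R) (T : process R) :
  test_supermartingale phi T -> test_supermartingale phi (average_with_one T).
Proof.
move=> [[T0 T1] /supermartingale_le0 hT]; split; [split=> [s|]|].
- by rewrite /average_with_one; have := T0 s; lra.
- by rewrite /average_with_one T1; lra.
- apply/supermartingale_le0 => s p Ip; rewrite expectation_average_with_one.
  by have := hT s p Ip; lra.
Qed.

(** * Randomness of paths *)

Lemma random_unit_forecast (R : realType) (A : set (process R))
    (omega : bit_path) :
  random A (stationary (unit_forecast R)) omega.
Proof.
move=> T _ [[_ T1] /supermartingale_le0 hT].
have le1 n : T (initial omega n) <= 1.
  elim: n => [|n IH]; first by rewrite /initial /= T1.
  rewrite [initial _ _]mkseqS; apply: le_trans IH; rewrite -subr_le0.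
  (* Taking for [p] the next outcome itself, the expectation is the actual increment along the
     path. *)
  have := hT (initial omega n) (omega n)%:R.
  rewrite /stationary /set_of_forecast /= in_itv /Defs.expectation /increment.
  case: (omega n) => /=; rewrite ?lexx ?ler01 /= => /(_ isT); lra.
apply: (@le_lt_trans _ _ 1%E); last exact: ltry.
by apply: ge_ereal_sup => _ [n _ <-]; rewrite lee_fin.
Qed.

Lemma limn_esup_le (R : realType) (u : nat -> \bar R) (l : \bar R) (N : nat) :
  (forall n, (N <= n)%N -> (u n <= l)%E) -> (limn_esup u <= l)%E.
Proof.
move=> h; rewrite limn_esup_lim (cvg_lim _ (@cvg_esups_inf _ u)) //.
apply: (@le_trans _ _ (esups u N)); first by apply: ereal_inf_lbound; exists N.
by apply: ge_ereal_sup => _ [n /= Nn <-]; exact: h.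
Qed.

Lemma random_schnorr (R : realType) (A : set (process R)) (hA : allowable A)
    (phi : forecasting_system R) (omega : bit_path) :
  random A phi omega -> schnorr_random phi omega.
Proof.
have [_ _ posA] := hA.
move=> hr T rho cT sT [_ rho_homo rho_unb].
have [[T0 _] _] := sT.
have sT' := test_supermartingale_average_with_one sT.
have AT' : A (average_with_one T).
  apply: posA; [exact: sT'.1| |exact: computable_average_with_one].
  by move=> s; rewrite /average_with_one; have := T0 s; lra.
have := hr _ AT' sT'; set S := ereal_sup _ => Sfin.
have leS n : (0 < n)%N -> ((average_with_one T (initial omega n))%:E <= S)%E.
  by move=> n0; apply: ereal_sup_ubound; exists n.
(* The value at [1] excludes [-oo]. *)
have [C SC] : exists C, S = C%:E.
  have := leS 1%N isT; move: Sfin; case: S {leS} => [C _ _|//|//].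
  by exists C.
(* From [(T + 1) / 2 <= C] follows [T <= 2 * C - 1], the level that [rho] has to exceed. *)
have [K hK] := rho_unb (Num.truncn (2 * C - 1)).
(* The successor ensures [0 < n], as [S] ignores the empty situation. *)
apply: (@limn_esup_le _ _ _ K.+1) => n Kn.
have := leS n (leq_trans (ltn0Sn K) Kn).
rewrite SC !lee_fin /average_with_one => hT.
have : (2 * C - 1) < (rho n)%:R.
  apply: lt_le_trans (truncnS_gt _) _.
  by rewrite ler_nat (leq_trans hK) // rho_homo // ltnW.
lra.
Qed.

Theorem proposition25 (R : realType) (A : set (process R)) (hA : allowable A)
    (omega : bit_path) :
  [/\ random_forecasts A omega (unit_forecast R),
      random_forecasts A omega `<=` schnorr_forecasts R omega,
      random_forecasts A omega !=set0 &
      schnorr_forecasts R omega !=set0].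
Proof.
have rand : random_forecasts A omega (unit_forecast R).
  exact: random_unit_forecast.
have sub : random_forecasts A omega `<=` schnorr_forecasts R omega.
  by move=> I; exact: random_schnorr.
by split=> //; exists (unit_forecast R) => //; exact: sub.
Qed.
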